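(* Let $\Sigma$ be a finite alphabet, let $K\subseteq\Omega_\Sigma$ be nonempty, compact, and shift-invariant, and suppose that $x_0\in K$ has a dense orbit in $K$. Define $L_{x_0}=\{u\in\Sigma^*:x_0(u)=1\}$. Then: 1. $x_{L_{x_0}}=x_0$; 2. $K_{L_{x_0}}=K$; 3. $X_{L_{x_0}}\cong\overline{\operatorname{span}\{\pi_u|_K:u\in\Sigma^*\}}^{\,C(K)}$ linearly and isometrically; 4. there exists a surjective linear isometry $$J_{L_{x_0}}:X_{L_{x_0}}\longrightarrow\overline{\operatorname{span}\{\pi_u|_K:u\in\Sigma^*\}}^{\,C(K)}$$ satisfying $J_{L_{x_0}}\bigl(\mathbf 1_{u^{-1}L_{x_0}}\bigr)=\pi_u|_K$ for every $u\in\Sigma^*$.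
   Context: All Banach spaces are real. $\Sigma$ is a finite nonempty alphabet, $\Sigma^*$ the free monoid of finite words over $\Sigma$. $\Omega_\Sigma=\{0,1\}^{\Sigma^*}$ carries the product topology ($\{0,1\}$ discrete). For $v\in\Sigma^*$, $\rho_v:\Omega_\Sigma\to\Omega_\Sigma$ is given by $(\rho_vx)(u)=x(uv)$; shift-invariant means $\rho_v(K)\subseteq K$ for every $v\in\Sigma^*$; the orbit of $x_0$ is $\{\rho_vx_0:v\in\Sigma^*\}$. For $u\in\Sigma^*$, $\pi_u:\Omega_\Sigma\to\mathbb R$, $\pi_u(x)=x(u)$. For a language $L\subseteq\Sigma^*$: $u^{-1}L=\{v\in\Sigma^*:uv\in L\}$; $\mathbf 1_B$ is the characteristic function of $B$; $X_L=\overline{\operatorname{span}}\{\mathbf 1_{u^{-1}L}:u\in\Sigma^*\}\subset\ell_\infty(\Sigma^* )$ (supremum-norm closure); $x_L=\mathbf 1_L\in\Omega_\Sigma$; and $K_L=\overline{\{\rho_vx_L:v\in\Sigma^*\}}\subseteq\Omega_\Sigma$. $C(K)$ is the Banach space of continuous real functions on $K$ with the supremum norm. *)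

(* Defs.v *)
From HB Require Import structures.
From mathcomp Require Import all_boot all_order all_algebra.
From mathcomp Require Import all_classical all_reals.
From mathcomp Require Import topology normedtype numfun.
Set Implicit Arguments.
Unset Strict Implicit.
Unset Printing Implicit Defensive.
Import Order.TTheory GRing.Theory Num.Theory.
Import numFieldNormedType.Exports.
Local Open Scope classical_set_scope.
Local Open Scope ring_scope.

Section sup_norm.
Context (T : Type) (R : realType).
Implicit Types (f g : T -> R).

Definition sup_norm f : R := sup [set `|f t| | t in [set: T]].

Lemma le_sup_norm f t : bounded_fun f -> `|f t| <= sup_norm f.
Proof.
move=> [M [Mr fM]]; apply: ub_le_sup; last by exists t.
by exists (M + 1) => _ [s _ <-]; apply: fM => //; rewrite ltrDl.
Qed.

Lemma sup_norm_ge0 f : 0 <= sup_norm f.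
Proof.
rewrite /sup_norm; set E := [set _ | _ in _].
have [Es|nEs] := pselect (has_sup E); last by rewrite sup_out.
have [y [t _ ty]] := Es.1; apply: (@le_trans _ _ y); first by rewrite -ty.
by apply: (ub_le_sup Es.2); exists t.
Qed.

Lemma sup_norm_le f M : 0 <= M -> (forall t, `|f t| <= M) -> sup_norm f <= M.
Proof.
move=> M0 fM; rewrite /sup_norm; set E := [set _ | _ in _].
have [->|/set0P E0] := eqVneq E set0; first by rewrite sup0.
by apply: ge_sup => // _ [t _ <-].
Qed.

Lemma sup_normD f g : bounded_fun f -> bounded_fun g ->
  sup_norm (f + g) <= sup_norm f + sup_norm g.
Proof.
move=> bf bg; apply: sup_norm_le => [|t]; first by rewrite addr_ge0 ?sup_norm_ge0.
by rewrite (le_trans (ler_normD _ _))// lerD// le_sup_norm.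
Qed.

Lemma sup_normZ a f : bounded_fun f -> sup_norm (a *: f) = `|a| * sup_norm f.
Proof.
move=> bf; apply/eqP; rewrite eq_le; apply/andP; split.
  apply: sup_norm_le => [|t]; first by rewrite mulr_ge0 ?sup_norm_ge0.
  by rewrite [(a *: f) t]/(a * f t) normrM ler_wpM2l ?le_sup_norm.
have [->|a0] := eqVneq a 0; first by rewrite normr0 mul0r sup_norm_ge0.
rewrite -ler_pdivlMl ?normr_gt0//; apply: sup_norm_le => [|t].
  by rewrite mulr_ge0 ?invr_ge0 ?sup_norm_ge0.
rewrite ler_pdivlMl ?normr_gt0// -normrM; apply: (@le_sup_norm (a *: f) t).
have [M [Mr fM]] := bf; exists (`|a| * (M + 1)); split.
  by rewrite realM ?normr_real// realD.
move=> x ltx s _; apply: le_trans (ltW ltx).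
by rewrite [X in `|X|]/(a * f s) normrM ler_wpM2l// fM// ltrDl.
Qed.

Lemma sup_norm_eq0 f : bounded_fun f -> sup_norm f = 0 -> f = 0.
Proof.
move=> bf f0; apply/funext => t; apply/eqP.
by rewrite -normr_le0 -f0 le_sup_norm.
Qed.

Definition bounded_pred : {pred T -> R} := mem [set f : T -> R | bounded_fun f].

Lemma bounded_submod_closed : submod_closed bounded_pred.
Proof.
split.
  by rewrite inE; exists 0; split => // x x0 t _ /=; rewrite normr0 ltW.
move=> a f g; rewrite !inE /= => -[M [Mr fM]] [N [Nr gN]].
exists (`|a| * (M + 1) + (N + 1)); split.
  by rewrite !(realD, realM) ?normr_real.
move=> x ltx s _; apply: le_trans (ltW ltx).
rewrite (le_trans (ler_normD _ _))// lerD//; last by rewrite gN// ltrDl.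
by rewrite [X in `|X|]/(a * f s) normrM ler_wpM2l// fM// ltrDl.
Qed.

HB.instance Definition _ := GRing.isSubmodClosed.Build R (T -> R) bounded_pred
  bounded_submod_closed.

End sup_norm.

Section ell_infty.
Context (R : realType) (T : Type).

Record ell_infty := EllInfty {
  ell_fun :> T -> R;
  ell_funP : ell_fun \in @bounded_pred T R }.

HB.instance Definition _ := [isSub for ell_fun].
HB.instance Definition _ := [Choice of ell_infty by <:].
HB.instance Definition _ := [SubChoice_isSubLmodule of ell_infty by <:].

Lemma ell_bounded (f : ell_infty) : bounded_fun f.
Proof. by have := ell_funP f; rewrite inE. Qed.

Let ell_norm (f : ell_infty) : R := sup_norm f.

Let ell_normD f g : ell_norm (f + g) <= ell_norm f + ell_norm g.
Proof. by apply: sup_normD; apply: ell_bounded. Qed.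

Let ell_normZ a f : ell_norm (a *: f) = `|a| * ell_norm f.
Proof. by apply: sup_normZ; apply: ell_bounded. Qed.

Let ell_norm_eq0 f : ell_norm f = 0 -> f = 0.
Proof. by move=> f0; apply/val_inj/sup_norm_eq0 => //; apply: ell_bounded. Qed.

HB.instance Definition _ := Lmodule_isNormed.Build R ell_infty
  ell_normD ell_normZ ell_norm_eq0.

Lemma ell_normE (f : ell_infty) : `|f| = sup_norm f.
Proof. by []. Qed.

Lemma bounded_indic (B : set T) : (\1_B : T -> R) \in @bounded_pred T R.
Proof.
rewrite inE; exists 1; split => // x x1 t _; apply: le_trans (ltW x1).
by rewrite /= indicE; case: (_ \in _); rewrite ?normr1 ?normr0.
Qed.

Definition ell_indic (B : set T) : ell_infty := EllInfty (bounded_indic B).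

End ell_infty.

Section continuous_functions.
Context (R : realType) (X : topologicalType).

Definition cont_pred (K : set X) : {pred K -> R} :=
  mem [set f : K -> R | continuous f].

Lemma cont_submod_closed (K : set X) : submod_closed (@cont_pred K).
Proof.
split; first by rewrite inE => x; apply: cst_continuous.
move=> a f g; rewrite !inE /= => cf cg x.
by apply: cvgD (cg x); apply: cvgZr (cf x).
Qed.

HB.instance Definition _ (K : set X) :=
  GRing.isSubmodClosed.Build R (K -> R) (@cont_pred K) (@cont_submod_closed K).

(* C(K): the domain K carries the subspace topology (of [set_type K]). The
   compactness proof is a parameter because the supremum norm needs it. *)
Record C_space (K : set X) (cK : compact K) := CSpace {
  C_fun :> K -> R;
  C_funP : C_fun \in @cont_pred K }.

Context (K : set X) (cK : compact K).

HB.instance Definition _ := [isSub for @C_fun K cK].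
HB.instance Definition _ := [Choice of C_space cK by <:].
HB.instance Definition _ := [SubChoice_isSubLmodule of C_space cK by <:].

Lemma compact_set_type : compact [set: K].
Proof.
move=> F PF _.
have FK : F (set_val @^-1` K).
  have -> : set_val @^-1` K = [set: K]; last exact: filterT.
  by apply/seteqP; split => // -[y yK] _; exact: set_mem yK.
have [p [Kp clp]] := @cK (set_val @ F) (fmap_proper_filter set_val PF) FK.
exists (exist _ p (mem_set Kp)); split => // A B FA [_ [[W oW <-] /= Wp] WB].
have [_ [[a Aa <-] Wa]] : set_val @` A `&` W !=set0.
  apply: clp; last by apply: open_nbhs_nbhs; split.
  suff: F (set_val @^-1` (set_val @` A)) by [].
  by apply: (@filterS _ F _ A) => // a Aa; exists a.
by exists a; split => //; apply: WB.
Qed.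

Lemma C_continuous (f : C_space cK) : continuous f.
Proof. by have := C_funP f; rewrite inE. Qed.

Lemma C_bounded (f : C_space cK) : bounded_fun f.
Proof.
have /compact_bounded : compact (f @` [set: K]).
  apply: continuous_compact compact_set_type.
  exact/continuous_subspaceT/C_continuous.
move=> [M [Mr fM]]; exists M; split => // x ltx t _.
by apply: (fM _ ltx); exists t.
Qed.

Let C_norm (f : C_space cK) : R := sup_norm f.

Let C_normD f g : C_norm (f + g) <= C_norm f + C_norm g.
Proof. by apply: sup_normD; apply: C_bounded. Qed.

Let C_normZ a f : C_norm (a *: f) = `|a| * C_norm f.
Proof. by apply: sup_normZ; apply: C_bounded. Qed.

Let C_norm_eq0 f : C_norm f = 0 -> f = 0.
Proof. by move=> f0; apply/val_inj/sup_norm_eq0 => //; apply: C_bounded. Qed.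

HB.instance Definition _ := Lmodule_isNormed.Build R (C_space cK)
  C_normD C_normZ C_norm_eq0.

Lemma C_normE (f : C_space cK) : `|f| = sup_norm f.
Proof. by []. Qed.

End continuous_functions.
Arguments C_space R {X K} cK.
Arguments ell_indic R {T} B.

Section closed_span.
Context (R : realType) (V : normedModType R).

Definition lin_span (A : set V) : set V :=
  [set v | exists (n : nat) (a : 'I_n -> R) (x : 'I_n -> V),
    (forall i, A (x i)) /\ v = \sum_(i < n) a i *: x i].

Definition closed_span (A : set V) : set V := closure (lin_span A).

End closed_span.

(* Only the restriction of [J] to the subspace [X] is meaningful: it is a
   linear isometry of [X] onto the subspace [Y]. *)
Definition surjective_linear_isometry (R : realType) (V W : normedModType R)
    (X : set V) (Y : set W) (J : V -> W) : Prop :=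
  [/\ forall (a : R) (u v : V), X u -> X v -> J (a *: u + v) = a *: J u + J v,
      forall u, X u -> `|J u| = `|u| &
      J @` X = Y].

Definition linearly_isometric (R : realType) (V W : normedModType R)
    (X : set V) (Y : set W) : Prop :=
  exists J : V -> W, surjective_linear_isometry X Y J.

Definition Omega (Sigma : finType) : Type := {ptws seq Sigma -> bool}.

HB.instance Definition _ (Sigma : finType) := Topological.on (Omega Sigma).

Section languages.
Context (R : realType) (Sigma : finType).
Implicit Types (K : set (Omega Sigma)) (x : Omega Sigma) (L : set (seq Sigma)).
Implicit Types (u v : seq Sigma).

Definition shift v x : Omega Sigma := fun u => x (u ++ v).

Definition shift_orbit x : set (Omega Sigma) := range (shift ^~ x).

Definition shift_invariant K := forall v, shift v @` K `<=` K.

Definition pi_ u x : R := (x u)%:R.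

Lemma pi_restr_cont K u : (pi_ u \o set_val : K -> R) \in @cont_pred R _ K.
Proof.
rewrite inE => y; apply: (@continuous_comp _ _ _ _ (pi_ u)).
  exact: initial_continuous.
apply: (@continuous_comp (Omega Sigma) bool R (fun x => x u) (fun b => b%:R)).
  exact: (@proj_continuous (seq Sigma) (fun=> bool) u).
move=> U /nbhs_singleton Ub.
by rewrite /= nbhs_principalE; apply/principal_filterP.
Qed.

Definition pi_restr K (cK : compact K) u : C_space R cK :=
  CSpace cK (pi_restr_cont K u).

Definition pi_closed_span K (cK : compact K) : set (C_space R cK) :=
  closed_span (range (pi_restr cK)).

Definition lquot u L : set (seq Sigma) := [set v | L (u ++ v)].

Definition X_lang L : set (ell_infty R (seq Sigma)) :=
  closed_span (range (fun u => ell_indic R (lquot u L))).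

Definition x_lang L : Omega Sigma := fun u => u \in L.

Definition K_lang L : set (Omega Sigma) := closure (shift_orbit (x_lang L)).

Definition lang_of x : set (seq Sigma) := [set u | x u = true].

End languages.
Arguments X_lang R {Sigma} L.
Arguments pi_restr R {Sigma K} cK u.
Arguments pi_closed_span R {Sigma K} cK.

(* Main.v *)
Require Import Defs.
From HB Require Import structures.
From mathcomp Require Import all_boot all_order all_algebra.
From mathcomp Require Import all_classical all_reals.
From mathcomp Require Import topology normedtype numfun.
From mathcomp Require Import lra.
Set Implicit Arguments.
Unset Strict Implicit.
Unset Printing Implicit Defensive.
Import Order.TTheory GRing.Theory Num.Theory.
Import numFieldNormedType.Exports.
Local Open Scope classical_set_scope.
Local Open Scope ring_scope.

(** The idea is to evaluate along the orbit.  The map [v |-> shift v x0] has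
    dense range in [K], so pulling continuous functions on [K] back along it
    is a linear isometry [E] from C(K) into the bounded functions on words,
    and [E] sends the coordinate [pi_u] to [v |-> x0 (u ++ v)], which is the
    indicator of the left quotient of the language of [x0] by [u].  A linear
    isometry with closed range matches the closed span of any family with the
    closed span of its image ([isometry_closed_span]), hence the inverse of
    [E] on its range is the required [J].

    The point with analytic content is that the range of [E] is closed
    ([pullback_range_closed]): a bounded function that is approximated
    uniformly by pullbacks is itself a pullback.  This is completeness of C(K)
    in the guise needed here.  Finally, the closure of the orbit is all of [K]
    because [K] is shift-invariant and, being compact in a Hausdorff space,
    closed. *)

(** * Linear isometries with closed range *)

Section isometry.
Context (R : realType).

Lemma closure_normP (V : normedModType R) (A : set V) (x : V) :
  closure A x <-> forall e : R, 0 < e -> exists2 y, A y & `|x - y| < e.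
Proof.
split=> [clA e e0|clA B].
  have [y [Ay xy]] := clA _ (nbhsx_ballx x e e0).
  by exists y => //; move: xy; rewrite -ball_normE.
move=> /nbhs_ballP[e e0 eB]; have [y Ay xy] := clA _ e0.
by exists y; split => //; apply: eB; rewrite -ball_normE.
Qed.

Context (V W : normedModType R) (E : {linear V -> W}).

Lemma linear_lin_span (A : set V) : E @` lin_span A = lin_span (E @` A).
Proof.
apply/seteqP; split=> [_ [_ [n [a [x [Ax ->]]]] <-]|_ [n [a [y [Ay ->]]]]].
  exists n, a, (E \o x); split; first by move=> i; exists (x i).
  by rewrite linear_sum; apply: eq_bigr => i _; rewrite linearZ.
have /choice[x xP] : forall i, exists x, A x /\ E x = y i.
  by move=> i; have [x Ax <-] := Ay i; exists x.
exists (\sum_i a i *: x i); first by exists n, a, x; split=> // i; case: (xP i).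
by rewrite linear_sum; apply: eq_bigr => i _; rewrite linearZ /= (xP i).2.
Qed.

Hypothesis isoE : forall x, `|E x| = `|x|.
Hypothesis closedE : closure (range E) `<=` range E.

(** An isometry reflects approximation as well as preserving it; the closed
    range supplies, for a limit of values [E y], the point [x] at which the
    reflected approximation takes place. *)
Lemma isometry_closure (S : set V) : E @` closure S = closure (E @` S).
Proof.
apply/seteqP; split=> [_ [x /closure_normP Sx <-]|w].
  apply/closure_normP => e /Sx[y Sy xy]; exists (E y); first by exists y.
  by rewrite -linearB isoE.
move=> clw; have [x _ xw] : range E w.
  by apply: closedE; apply: closureS clw => _ [y _ <-]; exists y.
exists x => //; apply/closure_normP => e e0.
have [_ [y Sy <-]] := (closure_normP _ _).1 clw _ e0.
by rewrite -xw -linearB isoE => xy; exists y.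
Qed.

Lemma isometry_closed_span (A : set V) :
  E @` closed_span A = closed_span (E @` A).
Proof. by rewrite /closed_span isometry_closure linear_lin_span. Qed.

Lemma isometry_inj : injective E.
Proof.
move=> x y Exy; apply/eqP; rewrite -subr_eq0 -normr_eq0.
by rewrite -isoE linearB /= Exy subrr normr0.
Qed.

(** The value [0] off the range of [E] is arbitrary, and makes the map non-linear
    there in general; only its restriction to the range is used. *)
Definition isometry_inverse (w : W) : V := xget 0 [set x | E x = w].

Lemma isometry_inverseK : cancel E isometry_inverse.
Proof.
move=> x; apply: isometry_inj; rewrite /isometry_inverse.
by case: xgetP => //= /(_ x).
Qed.

Lemma isometry_inverse_closed_span (A : set V) :
  surjective_linear_isometry (closed_span (E @` A)) (closed_span A)
    isometry_inverse.
Proof.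
rewrite -isometry_closed_span; split.
- move=> a _ _ [x _ <-] [y _ <-].
  by rewrite -linearP !isometry_inverseK.
- by move=> _ [x _ <-]; rewrite isometry_inverseK isoE.
- apply/seteqP; split=> [_ [_ [x Ax <-] <-]|x Ax].
    by rewrite isometry_inverseK.
  by exists (E x); [exists x|rewrite isometry_inverseK].
Qed.

End isometry.

(** * Pullback of continuous functions along a map with dense range *)

Section pullback.
Context (R : realType) (X : topologicalType) (K : set X) (cK : compact K).
Context (T : Type) (phi : T -> K).
Implicit Types f h : C_space R cK.

Lemma pullback_bounded f : f \o phi \in @bounded_pred T R.
Proof.
rewrite inE; have [M [Mr fM]] := C_bounded f.
by exists M; split=> // x Mx t _; apply: fM.
Qed.

Definition pullback f : ell_infty R T := EllInfty (pullback_bounded f).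

Lemma pullback_linear : linear pullback.
Proof. by move=> a f h; apply/val_inj. Qed.

HB.instance Definition _ :=
  GRing.isLinear.Build R (C_space R cK) (ell_infty R T) _ pullback
    pullback_linear.

Hypothesis phi_dense : closure (range phi) = [set: K].

(** The bound is a closed condition on [y], by continuity of [f].  Every
    comparison of functions on [K] below goes through this principle, which is
    why [pullback] loses no information. *)
Lemma dense_norm_le f (M : R) :
  (forall t, `|f (phi t)| <= M) -> forall y, `|f y| <= M.
Proof.
move=> fM y; have : closure (range phi) y by rewrite phi_dense.
have clM : closed [set z : K | `|f z| <= M].
  apply: (@preimage_closed _ _ (fun z : K => `|f z|) [set r | r <= M]).
    move=> z _; exact: (cvg_norm (C_continuous (f := f) (x := z))).
  exact: closed_le.
move=> cly; apply: (clM y); apply: closureS cly => _ [t _ <-].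
exact: fM.
Qed.

Lemma pullback_isometry f : `|pullback f| = `|f|.
Proof.
rewrite ell_normE C_normE; apply/eqP; rewrite eq_le; apply/andP; split.
  apply: sup_norm_le (sup_norm_ge0 _) _ => t.
  exact/(@le_sup_norm _ _ f)/C_bounded.
apply: sup_norm_le (sup_norm_ge0 _) _; apply: dense_norm_le => t.
exact/(@le_sup_norm _ _ (pullback f))/ell_bounded.
Qed.

(** Completeness of C(K) without sequences.  If [h] and [h'] pull back to within
    [e] and [e'] of [g], they differ by at most [e + e'] on the dense range of
    [phi], hence on [K].  Therefore the supremum over all such pairs of
    [h y - e] is within [e] of [h y] for every such pair: it is a uniform limit
    of continuous functions, and it pulls back to [g]. *)
Lemma pullback_range_closed : closure (range pullback) `<=` range pullback.
Proof.
move=> g /closure_normP clg.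
pose near_g h (e : R) := forall t, `|g t - h (phi t)| <= e.
have exh e : 0 < e -> exists h, near_g h e.
  move=> /clg[_ [h _ <-] gh]; exists h => t; apply: le_trans (ltW gh).
  exact/(@le_sup_norm _ _ (g - pullback h))/ell_bounded.
have near2 h h' e e' : near_g h e -> near_g h' e' ->
    forall y, `|h y - h' y| <= e + e'.
  move=> gh gh'; apply: (@dense_norm_le (h - h')) => t.
  rewrite -[X in `|X|]/(h (phi t) - h' (phi t)).
  have := gh t; have := gh' t; rewrite !ler_norml => /andP[? ?] /andP[? ?].
  by apply/andP; split; lra.
(* The value at [y] is bracketed by all the intervals [h y - e, h y + e], which
   meet pairwise by [near2]. *)
pose D y := [set r | exists h e, near_g h e /\ r = h y - e].
pose f y := sup (D y).
have ubD h e y : near_g h e -> ubound (D y) (h y + e).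
  move=> gh _ [h' [e' [gh' ->]]].
  by have := near2 _ _ _ _ gh gh' y; rewrite ler_norml => /andP[? ?]; lra.
have fh h e y : near_g h e -> `|f y - h y| <= e.
  move=> gh; have Dhe : D y (h y - e) by exists h, e.
  have le1 : h y - e <= f y.
    by apply: ub_le_sup Dhe; exists (h y + e); apply: ubD.
  have le2 : f y <= h y + e by apply: ge_sup; [exists (h y - e)|apply: ubD].
  by rewrite ler_norml; apply/andP; split; lra.
have cf : f \in @cont_pred R X K.
  rewrite inE => y; apply/(@cvgrPdist_lt _ _ _ (nbhs y)) => e e0.
  have e3 : 0 < e / 3 by rewrite divr_gt0.
  have [h gh] := exh _ e3.
  (* [3 * (e / 3)]: from [f] to [h] at [y], along [h], and back to [f] at [z]. *)
  have hy : h z @[z --> y] --> h y by exact: C_continuous.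
  have /(@cvgrPdist_lt _ _ _ (nbhs y))/(_ _ e3) := hy.
  apply: filterS => z; have := fh _ _ y gh; have := fh _ _ z gh.
  rewrite !ler_norml !ltr_norml => /andP[? ?] /andP[? ?] /andP[? ?].
  by apply/andP; split; lra.
exists (CSpace cK cf) => //; apply/val_inj/funext => t.
rewrite /= /comp; apply/eqP; rewrite -subr_eq0 -normr_le0.
apply/ler_addgt0Pl => e e0.
have e2 : 0 < e / 2 by rewrite divr_gt0.
have [h gh] := exh _ e2.
have := fh _ _ (phi t) gh; have := gh t.
rewrite addr0 !ler_norml => /andP[? ?] /andP[? ?].
by apply/andP; split; lra.
Qed.

End pullback.

(** * The orbit map *)

Section orbit.
Context (Sigma : finType).
Implicit Types (K : set (Omega Sigma)) (x : Omega Sigma).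

Lemma x_lang_of x : x_lang (lang_of x) = x.
Proof.
apply/funext => u; rewrite /x_lang /lang_of.
by case E: (x u); [apply/mem_set|apply/memNset; rewrite /= E].
Qed.

Lemma Omega_hausdorff : hausdorff_space (Omega Sigma).
Proof.
apply: (@hausdorff_product (seq Sigma) (fun=> bool)) => _.
exact: discrete_hausdorff.
Qed.

Lemma closure_shift_orbit K x : compact K -> shift_invariant K -> K x ->
  K `<=` closure (shift_orbit x) -> closure (shift_orbit x) = K.
Proof.
move=> cK K_shift Kx Kcl; apply/seteqP; split=> //.
apply: subset_trans (compact_closed Omega_hausdorff cK).
by apply: closureS => _ [v _ <-]; apply: (K_shift v); exists x.
Qed.

Context K (K_shift : shift_invariant K) x (Kx : K x).

Lemma shift_mem v : Defs.shift v x \in K.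
Proof. by rewrite inE; apply: (@K_shift v); exists x. Qed.

Definition orbit_map v : K := exist _ (Defs.shift v x) (shift_mem v).

(** [K] carries the topology induced by the inclusion, so density in the space
    [K] amounts to density among the points of [K] in the ambient product. *)
Lemma orbit_map_dense : K `<=` closure (shift_orbit x) ->
  closure (range orbit_map) = [set: K].
Proof.
move=> Kcl; apply/seteqP; split=> // -[y yK] _ B [_ [[U oU <-] /= Uy] UB].
have [_ [[v _ <-] Uv]] := Kcl _ (set_mem yK) _ (open_nbhs_nbhs (conj oU Uy)).
by exists (orbit_map v); split; [exists v|apply: UB].
Qed.

(** Both sides are [v |-> x (u ++ v)]: reading the coordinate [u] after shifting by
    [v] is the same as asking whether [v] lies in the left quotient by [u]. *)
Lemma pullback_orbit_pi (R : realType) (cK : compact K) u :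
  pullback orbit_map (pi_restr R cK u) = ell_indic R (lquot u (lang_of x)).
Proof.
apply/val_inj/funext => v; rewrite /= /comp /pi_ /= indicE; congr (_%:R).
by rewrite -[X in nat_of_bool X = _]/(x (u ++ v)) -{1}[x]x_lang_of.
Qed.

End orbit.

Theorem corollary7p3 (R : realType) (Sigma : finType)
    (Sigma_gt0 : (0 < #|Sigma|)%N)
    (K : set (Omega Sigma)) (K_neq0 : K !=set0) (cK : compact K)
    (K_shift : shift_invariant K)
    (x0 : Omega Sigma) (Kx0 : K x0) (x0_dense : K `<=` closure (shift_orbit x0)) :
  [/\ x_lang (lang_of x0) = x0,
      K_lang (lang_of x0) = K,
      linearly_isometric (X_lang R (lang_of x0)) (pi_closed_span R cK) &
      exists J : ell_infty R (seq Sigma) -> C_space R cK,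
        surjective_linear_isometry
          (X_lang R (lang_of x0)) (pi_closed_span R cK) J /\
        forall u : seq Sigma,
          J (ell_indic R (lquot u (lang_of x0))) = pi_restr R cK u].
Proof.
have phi_dense := orbit_map_dense K_shift Kx0 x0_dense.
pose E : {linear C_space R cK -> ell_infty R (seq Sigma)} :=
  pullback (orbit_map K_shift Kx0).
have isoE : forall f, `|E f| = `|f| := pullback_isometry phi_dense.
have closedE : closure (range E) `<=` range E by exact: pullback_range_closed.
have JP : surjective_linear_isometry (X_lang R (lang_of x0))
    (pi_closed_span R cK) (isometry_inverse E).
  have -> : X_lang R (lang_of x0) = closed_span (E @` range (pi_restr R cK)).
    rewrite image_comp /X_lang; congr closed_span; apply: eq_imagel => u _.
    by rewrite /= pullback_orbit_pi.
  exact: isometry_inverse_closed_span isoE closedE _.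
split.
- exact: x_lang_of.
- by rewrite /K_lang x_lang_of; apply: closure_shift_orbit.
- by exists (isometry_inverse E).
- exists (isometry_inverse E); split=> // u.
  by rewrite -(pullback_orbit_pi K_shift Kx0) (isometry_inverseK isoE).
Qed.
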